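(* Let $D$ be a division ring, let $n \ge 1$ be an integer, and let $R$ be a maximal commutative subring of the matrix ring $M_n(D)$. If $R$ contains no nonzero nilpotent elements, then $R$ is Artinian.
   Context: A division ring is not assumed to be commutative, nor finite dimensional over its center. $M_n(D)$ is the ring of $n \times n$ matrices over $D$. A maximal commutative subring of $M_n(D)$ is a commutative subring that is maximal with respect to inclusion among all commutative subrings of $M_n(D)$. *)

(* Defs.v *)
From mathcomp Require Import all_boot all_order all_algebra.
From mathcomp Require Import boolp classical_sets.

Set Implicit Arguments.
Unset Strict Implicit.
Unset Printing Implicit Defensive.

Local Open Scope classical_set_scope.
Local Open Scope ring_scope.

(* A [unitRingType] is noncommutative in general and satisfies 1 != 0. *)
Definition division_ring (D : unitRingType) : Prop :=
  forall x : D, x != 0 -> x \is a GRing.unit.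

(* Subrings are arbitrary (Prop-valued) subsets; [GRing.subring_closed]
   includes membership of the 1 of the ambient ring. *)
Definition comm_subring (A : pzRingType) (R : set A) : Prop :=
  GRing.subring_closed (mem R) /\ {in R &, forall x y, GRing.comm x y}.

Definition maximal_comm_subring (A : pzRingType) (R : set A) : Prop :=
  comm_subring R /\
  forall S : set A, comm_subring S -> R `<=` S -> S = R.

Definition nilpotent_elt (A : pzRingType) (x : A) : Prop :=
  exists k : nat, x ^+ k = 0.

(* Left ideals of the ring R, not of the ambient ring A; when R is commutative
   these are exactly the ideals of R. *)
Definition left_ideal_of (A : pzRingType) (R I : set A) : Prop :=
  [/\ I `<=` R,
      GRing.zmod_closed (mem I)
    & {in R & I, forall a x, a * x \in I}].

(* Descending chain condition on left ideals of R. *)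
Definition artinian_subring (A : pzRingType) (R : set A) : Prop :=
  forall I : nat -> set A,
    (forall k : nat, left_ideal_of R (I k)) ->
    (forall k : nat, I k.+1 `<=` I k) ->
    exists N : nat, forall k : nat, (N <= k)%N -> I k = I N.

(* Main.v *)
Require Import Defs.
From mathcomp Require Import all_boot all_order all_algebra.
From mathcomp Require Import boolp classical_sets.

Import GRing.Theory.

(** Why the theorem is true.

    Maximality makes [R] its own centralizer, so anything built canonically
    from an [x] in [R], in the sense of commuting with all that commutes with
    [x], lies in [R] again.  By Fitting's lemma some power [x ^+ k.+1] acts
    invertibly on its image, and hence has a group inverse, which is canonical
    in this sense ([exists_power_group_inverse], [group_inverse_comm]).  The
    associated idempotent [e] is in [R], and [x * (1 - e)] is nilpotent, hence
    zero.  So [R] is von Neumann regular: each [x] in [R] generates the same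
    ideal as an idempotent of [R] ([reduced_maximal_comm_regular]).

    A matrix ring over a division ring admits no infinite strictly monotone
    sequence of idempotents.  Applied to the idempotents [1 - e] with [e] in an
    ideal of [R], this yields a largest idempotent of the ideal, which must
    generate it ([ideal_idempotent_generator]).  Applied to the generators of a
    descending chain of ideals, it shows that the chain is stationary.

    Both finiteness arguments rest on the inner rank, the least [r] such that a
    matrix is a product through an [r]-dimensional space.  One fact of linear
    algebra over [D] suffices: a square matrix of size [r] is invertible or
    factors through a smaller size ([unit_or_factors_smaller]).  Given a set of
    matrices, one takes an element [B *m C] of least inner rank [r]; whenever
    [B *m g *m C] is in the set too, [g] is invertible. *)

Local Open Scope ring_scope.

(** * Inner rank over a division ring *)

Definition factors_through {D : pzRingType} {m n : nat} (r : nat)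
    (A : 'M[D]_(m, n)) : Prop :=
  exists (B : 'M[D]_(m, r)) (C : 'M[D]_(r, n)), A = B *m C.

Definition factors_below {D : pzRingType} {m n : nat} (r : nat)
    (A : 'M[D]_(m, n)) : Prop :=
  exists2 s, (s < r)%N & factors_through s A.

Lemma factors_below_mul {D : pzRingType} {m n p q r : nat}
    (P : 'M[D]_(m, n)) (A : 'M[D]_(n, p)) (Q : 'M[D]_(p, q)) :
  factors_below r A -> factors_below r (P *m A *m Q).
Proof.
move=> [s lt_sr [B [C ->]]]; exists s => //.
by exists (P *m B), (C *m Q); rewrite !mulmxA.
Qed.

(** Either the columns are independent, and a dual family of rows exists, or
    one column depends on the others and can be dropped.  The induction adds a
    column [b] to independent columns [B]: [c] is what remains of [b] after
    projecting onto the span of [B]. *)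
Lemma left_inverse_or_factors_smaller {D : unitRingType} {m r : nat}
    (hD : division_ring D) (A : 'M[D]_(m, r)) :
  (exists L : 'M[D]_(r, m), L *m A = 1%:M) \/ factors_below r A.
Proof.
elim: r A => [|r IHr]; first by left; exists 0; apply/matrixP => - [].
rewrite -[r.+1]/(1 + r)%N => A; rewrite -[A]hsubmxK.
set b := lsubmx _; set B : 'M_(m, r) := rsubmx _.
have [[L LB]|[s lt_sr [B1 [C1 defB]]]] := IHr B; last first.
  right; exists (1 + s)%N; first by rewrite add1n ltnS.
  exists (row_mx b B1), (block_mx 1%:M 0 0 C1).
  by rewrite mul_row_block !mulmx0 mulmx1 addr0 add0r -defB.
pose c := b - B *m (L *m b).
have [c0|] := eqVneq c 0.
  right; exists r => //; exists B, (row_mx (L *m b) 1%:M).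
  by rewrite mul_mx_row mulmx1 -(subr0_eq c0).
move=> c_neq0; left.
have [i ci_neq0] : exists i, c i 0 != 0.
  apply/existsP; apply: contra_neqT c_neq0 => /existsPn c_eq0.
  apply/matrixP => i j; rewrite (ord1 j).
  by have /negPn/eqP -> := c_eq0 i; rewrite mxE.
pose u : 'rV[D]_m := (c i 0)^-1 *: delta_mx 0 i.
have uc : u *m c = 1%:M.
  apply/matrixP => j k; rewrite !ord1 -scalemxAl -rowE mxE [row i c _ _]mxE.
  by rewrite mulVr ?hD // mxE eqxx.
(* [x] is the row dual to [b] and [L - L b x] the rows dual to [B]. *)
pose x := u - u *m B *m L.
have xB : x *m B = 0 by rewrite mulmxBl -!mulmxA LB mulmx1 subrr.
have xb : x *m b = 1%:M by rewrite -uc mulmxBl mulmxBr !mulmxA.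
exists (col_mx x (L - L *m b *m x)).
rewrite mul_col_row xb xB !mulmxBl LB -!mulmxA xB xb !mulmx0 mulmx1.
by rewrite subr0 subrr -scalar_mx_block.
Qed.

(** A left inverse [L] of [A] need not be assumed two-sided: if [L] itself has
    no left inverse then [L], hence also [A = A *m L *m A], drops in rank.  This
    spares a proof that the dimension over [D] is well defined. *)
Lemma unit_or_factors_smaller {D : unitRingType} {r : nat}
    (hD : division_ring D) (A : 'M[D]_r) :
  (exists2 L : 'M[D]_r, L *m A = 1%:M & A *m L = 1%:M) \/ factors_below r A.
Proof.
have [[L LA]|] := left_inverse_or_factors_smaller hD A; last by right.
have [[M ML]|ltL] := left_inverse_or_factors_smaller hD L.
  by left; exists L => //; rewrite -{1}[A]mul1mx -ML -(mulmxA M) LA mulmx1.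
by right; rewrite -[A]mulmx1 -LA mulmxA; apply: factors_below_mul.
Qed.

Lemma core_unit {D : unitRingType} {m n r : nat} (hD : division_ring D)
    (B : 'M[D]_(m, r)) (g : 'M[D]_r) (C : 'M[D]_(r, n)) :
  ~ factors_below r (B *m g *m C) ->
  exists2 h : 'M[D]_r, h *m g = 1%:M & g *m h = 1%:M.
Proof.
have [//|ltg] := unit_or_factors_smaller hD g.
by move=> notlt; case: notlt; apply: factors_below_mul.
Qed.

Lemma exists_least_rank {D : pzRingType} {m n : nat} {S : 'M[D]_(m, n) -> Prop}
    {A0 : 'M[D]_(m, n)} :
  S A0 ->
  exists (A : 'M[D]_(m, n)) (r : nat),
    [/\ S A, factors_through r A & forall A', S A' -> ~ factors_below r A'].
Proof.
move=> SA0; pose P r := `[< exists2 A, S A & factors_through r A >].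
have exP : exists r, P r.
  exists m; apply/asboolP; exists A0 => //.
  by exists 1%:M, A0; rewrite mul1mx.
case: (ex_minnP exP) => r /asboolP[A SA rA] minr.
exists A, r; split=> // A' SA' [s lt_sr sA'].
have /minr : P s by apply/asboolP; exists A'.
by rewrite leqNgt lt_sr.
Qed.

(** With [p = B *m C], write [q = B *m g *m C] for [g = C *m q *m B].  As
    [q] has rank [r], [g] is invertible, and the relations between [p] and [q]
    then force both [g] and [C *m B] to be [1]. *)
Lemma idempotent_eq_of_rank {D : unitRingType} {n r : nat}
    (hD : division_ring D) {p q : 'M[D]_n} :
  p * p = p -> q * q = q -> p * q = q -> q * p = q ->
  factors_through r p -> ~ factors_below r q -> q = p.
Proof.
rewrite -mulmxE => pp qq pq qp [B [C defp]] minq.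
pose u := C *m B; pose g := C *m q *m B.
have defq : q = B *m g *m C by rewrite !mulmxA -defp pq -mulmxA -defp qp.
have gug : g *m u *m g = g.
  have -> : g *m u *m g = C *m (q *m (B *m C) *m (B *m C) *m q) *m B.
    by rewrite !mulmxA.
  by rewrite -defp qp qp qq.
have ugu : u *m g *m u = g.
  have -> : u *m g *m u = C *m ((B *m C) *m q *m (B *m C)) *m B.
    by rewrite !mulmxA.
  by rewrite -defp pq qp.
have uuu : u *m u *m u = u *m u.
  have -> : u *m u *m u = C *m ((B *m C) *m (B *m C)) *m B by rewrite !mulmxA.
  by rewrite -defp pp {1}defp !mulmxA.
have [h hg gh] : exists2 h, h *m g = 1%:M & g *m h = 1%:M.
  by apply: (core_unit hD B _ C); rewrite -defq.
have ug1 : u *m g = 1%:M by rewrite -[LHS]mul1mx -hg -mulmxA (mulmxA g) gug.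
have u_g : u = g by rewrite -ugu ug1 mul1mx.
have uu1 : u *m u = 1%:M by rewrite {2}u_g.
have u1 : u = 1%:M by rewrite -[LHS]mulmx1 -uu1 mulmxA uuu.
by rewrite defq -u_g u1 mulmx1 -defp.
Qed.

(** * Fitting's lemma *)

(** [z] is the group inverse of [x], and [e = x * z] the projection onto the
    image of [x] along its kernel.  An element commuting with [x] preserves
    both, so it commutes with [e] and then with [z]. *)
Lemma group_inverse_comm {A : pzRingType} {x z y : A} :
  x * z = z * x -> x * z * x = x -> z * x * z = z ->
  GRing.comm y x -> GRing.comm y z.
Proof.
rewrite /GRing.comm => xz xzx zxz yx.
have ye : y * (x * z) = (x * z) * y * (x * z).
  rewrite {1}mulrA yx -{1}xzx -!mulrA; congr (_ * (_ * _)).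
  by rewrite !mulrA yx.
have ey : (x * z) * y = (x * z) * y * (x * z).
  rewrite xz -mulrA -yx -{1}xzx xz.
  by rewrite !mulrA -(mulrA z y z) -(mulrA z (y * z) x) -(mulrA y z x) -xz
    !mulrA -(mulrA z y x) yx !mulrA.
have ez : x * z * z = z by rewrite xz.
have ze : z * (x * z) = z by rewrite mulrA.
have ye_ey : y * (x * z) = x * z * y by rewrite ye -ey.
rewrite -[in LHS]ez mulrA ye_ey xz -!mulrA (mulrA x) -yx -mulrA ye_ey.
by rewrite mulrA ze.
Qed.

(** If [B *m C] has least rank among the powers of [A], then its square
    [B *m (C *m B) *m C] shows that [C *m B] is invertible, with inverse [h]
    say, and [B *m h *m h *m C] is the group inverse. *)
Lemma exists_power_group_inverse {D : unitRingType} {n : nat}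
    (hD : division_ring D) (A : 'M[D]_n) :
  exists (k : nat) (Z : 'M[D]_n), let X := A ^+ k.+1 in
    [/\ X * Z = Z * X, X * Z * X = X & Z * X * Z = Z].
Proof.
pose S (X : 'M[D]_n) := exists k, X = A ^+ k.+1.
have SA : S A by exists 0%N.
have [_ [r [[k ->] [B [C defX]] minX]]] := exists_least_rank SA.
have [h hg gh] : exists2 h, h *m (C *m B) = 1%:M & C *m B *m h = 1%:M.
  apply: (core_unit hD B _ C); apply: minX.
  exists (k.+1 + k)%N; rewrite -addnS exprD -mulmxE defX.
  by rewrite !mulmxA.
exists k, (B *m h *m h *m C); rewrite /= defX -mulmxE.
have XZ : B *m C *m (B *m h *m h *m C) = B *m h *m C.
  by rewrite !mulmxA -(mulmxA B C B) -(mulmxA B _ h) gh mulmx1.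
have ZX : B *m h *m h *m C *m (B *m C) = B *m h *m C.
  by rewrite !mulmxA -(mulmxA _ C B) -(mulmxA _ h (C *m B)) hg mulmx1.
split; first by rewrite XZ ZX.
  by rewrite XZ !mulmxA -(mulmxA _ C B) -(mulmxA _ h (C *m B)) hg mulmx1.
by rewrite ZX !mulmxA -(mulmxA _ C B) -(mulmxA _ h (C *m B)) hg mulmx1.
Qed.

(** * Maximal commutative subrings *)

(** The bicentralizer [S] of [R] together with [a] is a commutative subring,
    because these elements commute with each other. *)
Lemma maximal_comm_centralizer {A : pzRingType} {R : set A} {a : A} :
  maximal_comm_subring R -> {in R, forall x, GRing.comm a x} -> a \in R.
Proof.
move=> [[_ commR] maxR] aR.
pose G (x : A) : Prop := x \in R \/ x = a.
have GG x y : G x -> G y -> GRing.comm x y.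
  move=> [xR|->] [yR|->] //; first exact: commR.
    exact/commr_sym/aR.
  exact: aR.
pose cent x := forall y, G y -> GRing.comm x y.
pose S : set A := fun x => forall y, cent y -> GRing.comm x y.
have GS x : G x -> S x by move=> Gx y cy; exact/commr_sym/cy.
have SE x : (x \in S) <-> S x by rewrite inE.
have subS : comm_subring S.
  split; first split.
  - by apply/SE => y _; exact/commr_sym/commr1.
  - move=> x y /SE Sx /SE Sy; apply/SE => z cz; apply: commr_sym.
    by apply: commrB; apply: commr_sym; [apply: Sx|apply: Sy].
  - move=> x y /SE Sx /SE Sy; apply/SE => z cz; apply: commr_sym.
    by apply: commrM; apply: commr_sym; [apply: Sx|apply: Sy].
  move=> x y /SE Sx /SE Sy; apply: Sx => z Gz; apply: Sy.
  by move=> w Gw; apply: GG.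
have RS x : R x -> S x by move=> Rx; apply: GS; left; rewrite inE.
by rewrite -(maxR S subS RS); apply/SE/GS; right.
Qed.

Section ReducedMaximal.

Context {D : unitRingType} {n : nat} {R : set 'M[D]_n}.
Context (hD : division_ring D) (hR : maximal_comm_subring R).
Context (hred : forall x : 'M[D]_n, x \in R -> nilpotent_elt x -> x = 0).

Let R1 : 1 \in R. Proof. by case: hR => [[[]]]. Qed.
Let RB : {in R &, forall x y, x - y \in R}. Proof. by case: hR => [[[]]]. Qed.
Let RM : {in R &, forall x y, x * y \in R}. Proof. by case: hR => [[[]]]. Qed.
Let RC : {in R &, forall x y, x * y = y * x}. Proof. by case: hR => [[]]. Qed.

Let RX x k : x \in R -> x ^+ k \in R.
Proof. by move=> xR; elim: k => [|k IHk]; rewrite ?expr0 // exprS RM. Qed.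

Lemma reduced_maximal_comm_regular (x : 'M[D]_n) :
  x \in R -> exists2 s, s \in R & x * s * x = x.
Proof.
move=> xR; have [k [z [xz xzx zxz]]] := exists_power_group_inverse hD x.
have zR : z \in R.
  apply: (maximal_comm_centralizer hR) => y yR; apply: commr_sym.
  apply: (group_inverse_comm xz xzx zxz); apply: commrX; exact: RC.
pose e := x ^+ k.+1 * z.
have eR : e \in R by rewrite RM ?RX.
have ee : e * e = e by rewrite /e mulrA xzx.
have xe : x * (1 - e) = 0.
  apply: hred; first by rewrite RM ?RB.
  have eV j : (1 - e) ^+ j.+1 = 1 - e.
    elim: j => // j IHj; rewrite exprS IHj mulrBl mul1r mulrBr mulr1 ee.
    by rewrite subrr subr0.
  exists k.+1; rewrite exprMn_comm; last by apply: RC => //; apply: RB.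
  by rewrite eV mulrBr mulr1 /e xz mulrA xzx subrr.
exists (x ^+ k * z); first by rewrite RM ?RX.
rewrite mulrA -exprS (RC _ _ eR xR); apply/esym/eqP.
by rewrite -subr_eq0 -{1}[x]mulr1 -mulrBr xe.
Qed.

(** The generator [e] is chosen with [1 - e] of least rank.  For [x = x * f] in
    the ideal with [f] idempotent, the idempotent [e + f - e * f] is also in the
    ideal, and its complement [(1 - f) * (1 - e)] lies below [1 - e], so that
    the two are equal and [f] lies below [e]. *)
Lemma ideal_idempotent_generator (I : set 'M[D]_n) :
  left_ideal_of R I ->
  exists e, [/\ e \in I, e * e = e & {in I, forall x, x * e = x}].
Proof.
move=> [sIR [I0 IB] RI].
have IR x : x \in I -> x \in R by rewrite !inE; apply: sIR.
pose S (p : 'M[D]_n) := exists e, [/\ e \in I, e * e = e & p = 1 - e].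
have S1 : S 1 by exists 0; rewrite mulr0 subr0.
have [_ [r [[e [eI ee ->]] re minr]]] := exists_least_rank S1.
exists e; split=> // x xI.
have [s sR xsx] := reduced_maximal_comm_regular x (IR _ xI).
pose f := s * x; have fI : f \in I by exact: RI.
have xf : x * f = x by rewrite mulrA.
have ff : f * f = f by rewrite /f -mulrA xf.
have ef := RC _ _ (IR _ eI) (IR _ fI).
pose h := e - (e * f - f); have hI : h \in I.
  by rewrite IB // IB // RI // IR.
have idemC (g : 'M[D]_n) : g * g = g -> (1 - g) * (1 - g) = 1 - g.
  by move=> gg; rewrite mulrBl mul1r mulrBr mulr1 gg subrr subr0.
have defh : 1 - h = (1 - f) * (1 - e).
  rewrite mulrBl mul1r mulrBr mulr1 -ef /h.
  by rewrite -[e * f - f]opprB opprK opprD addrA.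
have comm1 : (1 - f) * (1 - e) = (1 - e) * (1 - f).
  by apply: RC; apply: RB => //; apply: IR.
have hh1 : (1 - h) * (1 - h) = 1 - h.
  rewrite defh {1}comm1 mulrA -(mulrA (1 - e)) (idemC f ff) -comm1 -mulrA.
  by rewrite (idemC e ee).
have hh : h * h = h by rewrite -[h](subKr 1) idemC.
have : 1 - h = 1 - e.
  apply: (idempotent_eq_of_rank hD) re _ => //; first exact: idemC.
  - by rewrite defh comm1 mulrA idemC.
  - by rewrite defh -mulrA idemC.
  by apply: minr; exists h.
rewrite defh => /(congr1 ( *%R f)).
rewrite mulrA [f * (1 - f)]mulrBr mulr1 ff subrr mul0r mulrBr mulr1.
move=> /esym/subr0_eq fe.
by rewrite -xf -mulrA -fe.
Qed.

End ReducedMaximal.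

Theorem corollary1p2 (D : unitRingType) (n : nat) (R : set 'M[D]_n)
    (hD : division_ring D) (hn : (1 <= n)%N)
    (hR : maximal_comm_subring R)
    (hred : forall x : 'M[D]_n, x \in R -> nilpotent_elt x -> x = 0) :
  artinian_subring R.
Proof.
move=> I idI decI.
pose gen k e := [/\ e \in I k, e * e = e & {in I k, forall x, x * e = x}].
have exgen k : exists e, gen k e.
  by exact: (ideal_idempotent_generator hD hR hred).
pose S e := exists k, gen k e.
have [e0 gen0] := exgen 0%N.
have Se0 : S e0 by exists 0%N.
have [p [r [[N [pI pp genp]] rp minr]]] := exists_least_rank Se0.
exists N => k leNk.
have sub x : x \in I k -> x \in I N.
  rewrite -(subnKC leNk) !inE.
  elim: (k - N)%N => [|j IHj]; first by rewrite addn0.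
  by rewrite addnS => /decI.
have [q genk] := exgen k; have [qI qq _] := genk.
have IR j x : x \in I j -> x \in R.
  by case: (idI j) => sIR _ _; rewrite !inE; apply: sIR.
have qp : q * p = q by apply: genp; apply: sub.
have pq : p * q = q by case: hR => [[_ ->]]; [|exact: IR pI|exact: IR qI].
have q_p : q = p.
  by apply: (idempotent_eq_of_rank hD pp qq pq qp rp); apply: minr; exists k.
apply: funext => x; apply: propext; split => [Ikx|INx].
  by have := sub x; rewrite !inE; apply.
have xI : x \in I N by rewrite inE.
have [_ _ RI] := idI k.
have : x * q \in I k by apply: RI => //; apply: IR xI.
by rewrite q_p (genp x xI) inE.
Qed.
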